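(* Let $\lambda_0,\lambda_1,c_0,c_1>0$ and let $[a,b]$, $a<b$, be a closed interval. Let $\{X(t)\}_{t\ge 0}$ be the telegraph process with drift, having velocity $c_0$ and switching intensity $\lambda_0$ when moving rightwards (direction $d_0$), and velocity $c_1$ and switching intensity $\lambda_1$ when moving leftwards (direction $d_1$). Let $D(t)$ be its direction at time $t$ and $\tau=\inf\{t>0:\ X(t)\notin[a,b]\}$. For $x\in[a,b]$ and $j=0,1$ put $$h_j(x)=\mathbb{E}\big[\tau\,\big|\,X(0)=x,\ D(0)=d_j\big],\qquad h(x)=\mathbb{E}\big[\tau\,\big|\,X(0)=x\big]=\frac{h_0(x)+h_1(x)}{2}.$$ Then for $x\in[a,b]$, $$\begin{aligned}h_0(x)=\;&\frac{\lambda_0+\lambda_1}{\lambda_0c_1-\lambda_1c_0}(x-a)-\frac{(\lambda_0+\lambda_1)(b-a)}{\lambda_0c_1-\lambda_1c_0}\cdot\frac{\lambda_0c_1\,e^{\left(\frac{\lambda_0}{c_0}-\frac{\lambda_1}{c_1}\right)x}-\lambda_1c_0\,e^{\left(\frac{\lambda_0}{c_0}-\frac{\lambda_1}{c_1}\right)a}}{\lambda_0c_1\,e^{\left(\frac{\lambda_0}{c_0}-\frac{\lambda_1}{c_1}\right)b}-\lambda_1c_0\,e^{\left(\frac{\lambda_0}{c_0}-\frac{\lambda_1}{c_1}\right)a}}\\&+\frac{\lambda_0c_1(c_0+c_1)}{\lambda_0c_1-\lambda_1c_0}\cdot\frac{e^{\left(\frac{\lambda_0}{c_0}-\frac{\lambda_1}{c_1}\right)b}-e^{\left(\frac{\lambda_0}{c_0}-\frac{\lambda_1}{c_1}\right)x}}{\lambda_0c_1\,e^{\left(\frac{\lambda_0}{c_0}-\frac{\lambda_1}{c_1}\right)b}-\lambda_1c_0\,e^{\left(\frac{\lambda_0}{c_0}-\frac{\lambda_1}{c_1}\right)a}}\end{aligned}$$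 and $$\begin{aligned}h_1(x)=\;&\frac{\lambda_0+\lambda_1}{\lambda_0c_1-\lambda_1c_0}(x-a)\\&-\lambda_1c_0\,\frac{c_0+c_1+(\lambda_0+\lambda_1)(b-a)}{\lambda_0c_1-\lambda_1c_0}\cdot\frac{e^{\left(\frac{\lambda_0}{c_0}-\frac{\lambda_1}{c_1}\right)x}-e^{\left(\frac{\lambda_0}{c_0}-\frac{\lambda_1}{c_1}\right)a}}{\lambda_0c_1\,e^{\left(\frac{\lambda_0}{c_0}-\frac{\lambda_1}{c_1}\right)b}-\lambda_1c_0\,e^{\left(\frac{\lambda_0}{c_0}-\frac{\lambda_1}{c_1}\right)a}}.\end{aligned}$$ Consequently, $$\begin{aligned}h(x)=\;&\frac{\lambda_0+\lambda_1}{\lambda_0c_1-\lambda_1c_0}(x-a)\\&-\frac{(\lambda_0+\lambda_1)(b-a)}{2(\lambda_0c_1-\lambda_1c_0)}\cdot\frac{(\lambda_0c_1+\lambda_1c_0)\,e^{\left(\frac{\lambda_0}{c_0}-\frac{\lambda_1}{c_1}\right)x}-2\lambda_1c_0\,e^{\left(\frac{\lambda_0}{c_0}-\frac{\lambda_1}{c_1}\right)a}}{\lambda_0c_1\,e^{\left(\frac{\lambda_0}{c_0}-\frac{\lambda_1}{c_1}\right)b}-\lambda_1c_0\,e^{\left(\frac{\lambda_0}{c_0}-\frac{\lambda_1}{c_1}\right)a}}\\&+\frac{c_0+c_1}{2(\lambda_0c_1-\lambda_1c_0)}\cdot\frac{\lambda_0c_1\,e^{\left(\frac{\lambda_0}{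c_0}-\frac{\lambda_1}{c_1}\right)b}-(\lambda_0c_1+\lambda_1c_0)\,e^{\left(\frac{\lambda_0}{c_0}-\frac{\lambda_1}{c_1}\right)x}+\lambda_1c_0\,e^{\left(\frac{\lambda_0}{c_0}-\frac{\lambda_1}{c_1}\right)a}}{\lambda_0c_1\,e^{\left(\frac{\lambda_0}{c_0}-\frac{\lambda_1}{c_1}\right)b}-\lambda_1c_0\,e^{\left(\frac{\lambda_0}{c_0}-\frac{\lambda_1}{c_1}\right)a}}.\end{aligned}$$
   Context: Telegraph process with drift: a particle starts at $X(0)=x\in[a,b]$ and at time $0$ starts moving rightwards (direction $d_0$) or leftwards (direction $d_1$), each with probability $\frac12$. While its direction is $d_0$ it moves right with velocity $c_0$ and reverses direction with intensity $\lambda_0$; while its direction is $d_1$ it moves left with velocity $c_1$ and reverses direction with intensity $\lambda_1$. The drift may come from the difference between the velocities, from the difference between the switching intensities, or from both. If the process starts at $b$ with direction $d_0$, or at $a$ with direction $d_1$, it exits the interval immediately, so that $h_0(b)=0$ and $h_1(a)=0$. *)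

(* Defs.v *)
From HB Require Import structures.
From mathcomp Require Export all_boot all_order all_algebra.
From mathcomp Require Export all_classical all_reals all_analysis.
Export Order.TTheory GRing.Theory Num.Theory.
Export numFieldNormedType.Exports.

Set Implicit Arguments.
Unset Strict Implicit.
Unset Printing Implicit Defensive.

Local Open Scope classical_set_scope.
Local Open Scope ring_scope.

(* Directions are booleans, so that n reversals turn j into [j (+) odd n]. *)
Definition d0 : bool := false. (* rightwards *)
Definition d1 : bool := true.  (* leftwards *)

Section telegraph.
Context (dT : measure_display) (T : measurableType dT) (R : realType).
Variable P : probability T R.

Definition signed_velocity (c0 c1 : R) (j : bool) : R :=
  if j == d0 then c0 else - c1.

Definition intensity (lambda0 lambda1 : R) (j : bool) : R :=
  if j == d0 then lambda0 else lambda1.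

(* The (n+1)-st sojourn lasts W n, so the n-th reversal happens at this time
   (time 0 being the start of the sojourn number 0). *)
Definition reversal_time (W : nat -> T -> R) (n : nat) (w : T) : R :=
  \sum_(i < n) W i w.

(* Telegraph process (X, D) started at x, with sojourn times W.  Reversing
   with intensity lambda_j while in direction d_j means that, given the initial
   direction, the successive sojourns are independent and exponential, with the
   rate of the current direction: this is [tp_sojourn].  The sample paths are
   the regular ones: positive sojourns, finitely many reversals in bounded
   time.  Only the times t >= 0 are constrained. *)
Record telegraph_with (c0 c1 lambda0 lambda1 x : R)
    (X : R -> {RV P >-> R}) (D : R -> {RV P >-> bool})
    (W : nat -> {RV P >-> R}) : Prop := {
  tp_start : forall w, X 0 w = x ;
  tp_direction0 : forall j, P [set w | D 0 w = j] = (2^-1)%:E ;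
  tp_sojourn_gt0 : forall n w, 0 < W n w ;
  tp_nonexplosive : forall w, reversal_time W n w @[n --> \oo] --> +oo ;
  tp_sojourn : forall (j : bool) (n : nat) (A : nat -> set R),
    (forall i, measurable (A i)) ->
    P ([set w | D 0 w = j] `&` [set w | forall i, (i < n)%N -> A i (W i w)]) =
    (P [set w | D 0%R w = j] *
     \prod_(i < n)
        exponential_prob (intensity lambda0 lambda1 (j (+) odd i)) (A i))%E ;
  tp_direction : forall (n : nat) (t : R) (w : T),
    reversal_time W n w <= t < reversal_time W n.+1 w ->
    D t w = D 0 w (+) odd n ;
  tp_motion : forall (j : bool) (s t : R) (w : T), 0 <= s <= t ->
    (forall u : R, s <= u < t -> D u w = j) ->
    X t w = X s w + signed_velocity c0 c1 j * (t - s)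
}.

Definition telegraph_process (c0 c1 lambda0 lambda1 x : R)
    (X : R -> {RV P >-> R}) (D : R -> {RV P >-> bool}) : Prop :=
  exists W : nat -> {RV P >-> R},
    telegraph_with c0 c1 lambda0 lambda1 x X D W.

(* Extended-real valued: a path that never leaves [a, b] has exit time +oo. *)
Definition exit_time (a b : R) (X : R -> T -> R) (w : T) : \bar R :=
  ereal_inf [set t%:E | t in [set t : R | 0 < t /\ X t w \notin `[a, b]]].

(* E[Y | A] for an event A of positive probability and Y >= 0. *)
Definition cond_expectation (Y : T -> \bar R) (A : set T) : \bar R :=
  (\int[P]_(w in A) Y w / P A)%E.

End telegraph.

(* Main.v *)
From HB Require Import structures.
Require Import Defs.
From mathcomp Require Import all_boot all_order all_algebra.
From mathcomp Require Import all_classical all_reals all_analysis.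
From mathcomp Require Import measurable_realfun ring lra.
Import Order.TTheory GRing.Theory Num.Theory numFieldNormedType.Exports.

Set Implicit Arguments.
Unset Strict Implicit.
Unset Printing Implicit Defensive.

Local Open Scope classical_set_scope.
Local Open Scope ring_scope.

(** Between two reversals the particle moves in a straight line, so the path is
    determined by the initial direction and the sojourns W_0, W_1, etc.: the
    n-th turning point is Y_n = x + sum_(i < n) v_i W_i.  As long as Y_0, ...,
    Y_n all lie in the segment, the particle spends min(W_n, r_n) further units
    of time in it, where r_n is the time it needs from Y_n to reach the end
    ahead of it; it leaves during the sojourn n exactly when r_n < W_n.  Hence
    on every path the exit time is the sum over n of these contributions
    ([cvg_sum_sojourn_inside]); if the path never leaves, the sum is infinite
    because the reversals do not accumulate.

    Let H_0, H_1 solve the boundary value problem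
      v_i H_i' = lambda_i (H_i - H_(1-i)) - 1,  H_0(b) = 0,  H_1(a) = 0.
    Multiplying the equation by the exponential density and integrating along a
    leg that starts at y with direction i yields the renewal equation
      H_i(y) = E[min(W, r) + 1_(W <= r) H_(1-i)(y + v_i W)]
    with W exponential of rate lambda_i ([integral_exponential_deadline]).
    Since W_n is independent of W_0, ..., W_(n-1), hence of Y_n and of the event
    that the particle is still inside, the renewal equation can be used at the
    random point Y_n ([ge0_integral_next_sojourn]).  Summing over n, on the
    event of initial direction j, of probability p_j,
      p_j H_j(x) = E[contributions of the first n sojourns]
                   + E[H(Y_n); inside until Y_n].
    To be inside until Y_n all of the first n sojourns must be shorter than a
    fixed time, an event of geometrically small probability, so the remainder
    tends to 0 and p_j H_j(x) is the integral of the exit time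
    ([mean_exit_time]).  Only nonnegative solutions are considered, so that
    Tonelli and monotone convergence suffice.

    It remains to check that the two displayed functions solve the boundary
    value problem, which is algebra, and that they are nonnegative on the
    segment.  The latter follows from the tangent inequality 1 + u <= exp u:
    both functions lie above their chord over the segment, and the value at
    the end behind the particle is a nonnegative combination of
    (lambda0 c1 - lambda1 c0)^2 and of a gap in that inequality
    ([mean_exit_solution_ge0]). *)

(** * Integration against a density *)

Section density.
Local Open Scope ereal_scope.
Context d (T : measurableType d) (R : realType).
Variables (mu nu : {measure set T -> \bar R}) (p : T -> R).
Hypotheses (mp : measurable_fun setT p) (p0 : forall x, (0 <= p x)%R).
Hypothesis nuE : forall A, measurable A -> nu A = \int[mu]_(x in A) (p x)%:E.

Import HBNNSimple.

Let mpE : measurable_fun setT (EFin \o p).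
Proof. exact/measurable_EFinP. Qed.

Let density_indic (A : set T) : measurable A ->
  \int[nu]_x (\1_A x)%:E = \int[mu]_x ((\1_A x)%:E * (p x)%:E).
Proof.
move=> mA; rewrite integral_indic// setIT nuE// integral_mkcond.
apply: eq_integral => x _; rewrite patchE indicE.
by case: (x \in A); rewrite ?mul1e ?mul0e.
Qed.

Let density_nnsfun (f : {nnsfun T >-> R}) :
  \int[nu]_x (f x)%:E = \int[mu]_x ((f x)%:E * (p x)%:E).
Proof.
under [LHS]eq_integral do rewrite fimfunE -fsumEFin//.
rewrite [LHS]ge0_integral_fsum//; last 2 first.
  - by move=> r; exact/measurable_EFinP/measurableT_comp.
  - by move=> n x _; rewrite EFinM nnfun_muleindic_ge0.
under [RHS]eq_integral.
  move=> x _; rewrite fimfunE -fsumEFin// muleC ge0_mule_fsumr; last first.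
    by move=> r; rewrite EFinM nnfun_muleindic_ge0.
  over.
rewrite [RHS]ge0_integral_fsum//; last 2 first.
  - move=> r; apply: emeasurable_funM => //.
    exact/measurable_EFinP/measurableT_comp.
  - move=> r x _; apply: mule_ge0; first by rewrite lee_fin.
    exact: nnfun_muleindic_ge0.
apply: eq_fsbigr => r _.
have [r0|r0] := ltP r 0%R.
  have f0 : f @^-1` [set r] = set0 by rewrite preimage_nnfun0.
  by rewrite !integral0_eq// => x _; rewrite f0 indic0/= ?(mulr0,mule0).
under eq_integral do rewrite EFinM.
rewrite ge0_integralZl//; last first.
  exact/measurable_EFinP/measurable_indic.
under [RHS]eq_integral do rewrite EFinM muleCA.
rewrite ge0_integralZl//; last 2 first.
- by apply: emeasurable_funM => //; exact/measurable_EFinP/measurable_indic.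
- by move=> x _; rewrite mule_ge0// lee_fin.
rewrite density_indic//; congr (_ * _).
by apply: eq_integral => x _; rewrite muleC.
Qed.

Let ge0_integral_densityT (f : T -> \bar R) :
  measurable_fun setT f -> (forall x, 0 <= f x) ->
  \int[nu]_x f x = \int[mu]_x (f x * (p x)%:E).
Proof.
move=> mf f0; pose f_ := nnsfun_approx measurableT mf.
have cf x : (f_ n x)%:E @[n --> \oo] --> f x by exact: cvg_nnsfun_approx.
have ndf x : {homo (fun n => (f_ n x)%:E) : m n / (m <= n)%N >-> m <= n}.
  by move=> m n mn; rewrite lee_fin; exact/lefP/nd_nnsfun_approx.
transitivity (limn (fun n => \int[nu]_x (f_ n x)%:E)).
  rewrite -monotone_convergence//=.
  - by apply: eq_integral => x _; apply/esym/cvg_lim.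
  - by move=> n; exact/measurable_EFinP.
  - by move=> n x _; rewrite lee_fin.
transitivity (limn (fun n => \int[mu]_x ((f_ n x)%:E * (p x)%:E))).
  by congr (limn _); apply/funext => n; exact: density_nnsfun.
rewrite -monotone_convergence//=.
- by apply: eq_integral => x _; apply/cvg_lim => //; exact: cvgeZr.
- by move=> n; apply: emeasurable_funM => //; exact/measurable_EFinP.
- by move=> n x _; rewrite mule_ge0// lee_fin.
- by move=> x _ m n mn; rewrite lee_wpmul2r// ?lee_fin//; exact: ndf.
Qed.

Lemma ge0_integral_density (D : set T) (f : T -> \bar R) : measurable D ->
  measurable_fun D f -> (forall x, D x -> 0 <= f x) ->
  \int[nu]_(x in D) f x = \int[mu]_(x in D) (f x * (p x)%:E).
Proof.
move=> mD mf f0; rewrite integral_mkcond ge0_integral_densityT.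
- rewrite [RHS]integral_mkcond; apply: eq_integral => x _; rewrite !patchE.
  by case: ifP => //; rewrite mul0e.
- exact/(measurable_restrictT _ mD).1.
- by move=> x; exact: erestrict_ge0.
Qed.

End density.

Section restriction.
Local Open Scope ereal_scope.
Context d (T : measurableType d) (R : realType).
Variables (mu : {measure set T -> \bar R}) (D : set T) (mD : measurable D).

(** The restriction of [mu] to [D] has density [\1_D]. *)
Lemma ge0_integral_mrestr (f : T -> \bar R) :
  measurable_fun setT f -> (forall x, 0 <= f x) ->
  \int[mrestr mu mD]_x f x = \int[mu]_(x in D) f x.
Proof.
move=> mf f0.
rewrite (@ge0_integral_density _ _ _ mu (mrestr mu mD) \1_D)//.
- rewrite [RHS]integral_mkcond; apply: eq_integral => x _.
  rewrite patchE indicE; case: (x \in D); by rewrite ?mule1 ?mule0.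
- by move=> A mA; rewrite integral_indic// /mrestr setIC.
Qed.

End restriction.

(** * Independence of the next sojourn from the past *)

Section freezing.
Local Open Scope ereal_scope.
Context d d1 d2 (T : measurableType d) (T1 : measurableType d1)
  (T2 : measurableType d2) (R : realType).
Variables (mu : {finite_measure set T -> \bar R}) (nu : probability T2 R).
Variables (Y : T -> T1) (Z : T -> T2).
Hypotheses (mY : measurable_fun setT Y) (mZ : measurable_fun setT Z).
Hypothesis YZ : forall A B, measurable A -> measurable B ->
  mu (Y @^-1` A `&` Z @^-1` B) = mu (Y @^-1` A) * nu B.

Let law : set T1 -> \bar R := pushforward mu Y.

Let law0 : law set0 = 0.
Proof. by rewrite /law /pushforward preimage_set0 measure0. Qed.

Let law_ge0 A : 0 <= law A.
Proof. exact: measure_ge0. Qed.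

Let law_sigma_additive : semi_sigma_additive law.
Proof.
exact: (@measure_semi_sigma_additive _ _ _
  (measure_function_pushforward__canonical__measure_function_Measure mu mY)).
Qed.

Let law_fin : fin_num_fun law.
Proof.
move=> A mA; apply: fin_num_measure; rewrite -[X in measurable X]setTI.
exact: mY.
Qed.

HB.instance Definition _ :=
  isMeasure.Build _ _ _ law law0 law_ge0 law_sigma_additive.
HB.instance Definition _ := Measure_isFinite.Build _ _ _ law law_fin.

(** By independence the joint law of [(Y, Z)] is a product measure, so Tonelli
    lets one average over [Z] while [Y] is frozen. *)
Lemma ge0_integral_freezing (G : T1 * T2 -> \bar R) :
  measurable_fun setT G -> (forall u, 0 <= G u) ->
  \int[mu]_w G (Y w, Z w) = \int[mu]_w \int[nu]_s G (Y w, s).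
Proof.
move=> mG G0.
have mYZ : measurable_fun setT (fun w => (Y w, Z w)).
  exact: measurable_fun_pair.
transitivity (\int[pushforward mu (fun w => (Y w, Z w))]_u G u).
  by rewrite ge0_integral_pushforward.
transitivity (\int[law \x nu]_u G u).
  apply: eq_measure_integral => A mA _; apply/esym.
  by apply: product_measure_unique => //= B C mB mC; exact: YZ.
rewrite fubini_tonelli1// /fubini_F ge0_integral_pushforward//.
  exact: measurable_fun_fubini_tonelli_F.
by move=> y _; exact: integral_ge0.
Qed.

End freezing.

Section past.
Local Open Scope ereal_scope.
Context d (T : measurableType d) (R : realType) (P : probability T R).
Variables (W : nat -> {RV P >-> R}).

(** Cylinders generate the sigma-algebra of the first [n] sojourns and are
    stable under intersection; independence is postulated on them only. *)
Definition cylinders (n : nat) : set (set T) :=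
  [set E | exists2 A : nat -> set R, (forall i, measurable (A i)) &
     E = [set w | forall i, (i < n)%N -> A i (W i w)]].

Lemma measurable_cylinders n : cylinders n `<=` measurable.
Proof.
move=> _ [A mA ->].
rewrite [X in measurable X](_ : _ = \bigcap_(i < n) (W i @^-1` A i))//.
apply: bigcap_measurableType => i _; rewrite -[X in measurable X]setTI.
exact: measurable_funPT.
Qed.

Lemma setI_closed_cylinders n : setI_closed (cylinders n).
Proof.
move=> _ _ [A mA ->] [B mB ->]; exists (fun i => A i `&` B i).
  by move=> i; exact: measurableI.
apply/seteqP; split => [w [Aw Bw] i ni|w ABw].
  by split; [exact: Aw|exact: Bw].
by split => i ni; have [] := ABw _ ni.
Qed.

Lemma setT_cylinders n : cylinders n setT.
Proof. by exists (fun=> setT) => //; apply/seteqP; split. Qed.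

Lemma measurable_past n E : <<s cylinders n >> E -> measurable E.
Proof.
apply: smallest_sub; first exact: sigma_algebra_measurable.
exact: measurable_cylinders.
Qed.

Lemma measurable_sojourn_past n i : (i < n)%N ->
  measurable_fun setT (W i : g_sigma_algebraType (cylinders n) -> R).
Proof.
move=> ni _ A mA; rewrite setTI; apply: sub_sigma_algebra.
exists (fun k => if k == i then A else setT).
  by move=> k; case: ifP.
apply/seteqP; split => [w Aw k _|w /(_ _ ni)]; last by rewrite eqxx.
by case: eqP => [->|].
Qed.

Variables (S : set T) (mS : measurable S) (nu : nat -> probability R R).
Hypothesis SW : forall n (A : nat -> set R), (forall i, measurable (A i)) ->
  P (S `&` [set w | forall i, (i < n)%N -> A i (W i w)]) =
  P S * \prod_(i < n) nu i (A i).

(** Both sides are finite measures in [E] that agree on the cylinders, which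
    form a pi-system containing the whole space. *)
Lemma past_independence n E B : <<s cylinders n >> E -> measurable B ->
  P (S `&` E `&` W n @^-1` B) = P (S `&` E) * nu n B.
Proof.
move=> sE mB.
have mWB : measurable (S `&` W n @^-1` B).
  apply: measurableI => //; rewrite -[X in measurable X]setTI.
  exact: measurable_funPT.
have nuB0 : (0 <= fine (nu n B))%R by rewrite fine_ge0.
pose m2 := mscale (NngNum nuB0) (mrestr P mS).
suff : mrestr P mWB E = m2 E.
  rewrite /m2 /mscale/= /mrestr fineK ?fin_num_measure// muleC.
  by rewrite (setIC S E) => <-; rewrite -setIA.
apply: (g_sigma_algebra_measure_unique (cylinders n) _ (fun=> setT)) => //.
- exact: measurable_cylinders.
- by move=> _; exact: setT_cylinders.
- by rewrite bigcup_const//; exists 0%N.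
- exact: setI_closed_cylinders.
- move=> _ [A mA ->]; set E' := [set w | _].
  change (P (E' `&` (S `&` W n @^-1` B)) =
    (fine (nu n B))%:E * P (E' `&` S)).
  rewrite fineK ?fin_num_measure//.
  (* The event on W_n is the n-th side of an n.+1-dimensional cylinder. *)
  pose A' i := if (i < n)%N then A i else B.
  have mA' i : measurable (A' i) by rewrite /A'; case: ifP.
  have A'n : A' n = B by rewrite /A' ltnn.
  have := SW n.+1 mA'; rewrite big_ord_recr/= A'n => SWA'.
  rewrite [in RHS]setIC SW// muleC -muleA.
  have -> : \prod_(i < n) nu i (A i) = \prod_(i < n) nu i (A' i).
    by apply: eq_bigr => i _; rewrite /A' ltn_ord.
  rewrite -SWA'; congr (P _); apply/seteqP; split => w.
    move=> [Aw [Sw Bw]]; split => // i; rewrite ltnS leq_eqVlt.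
    move=> /predU1P[->|ni]; first by rewrite A'n.
    by rewrite /A' ni; exact: Aw.
  move=> [Sw A'w]; split => [i ni|].
    by have := A'w i (ltnW ni); rewrite /A' ni.
  by split => //; have := A'w n (ltnSn n); rewrite A'n.
- by move=> _; rewrite ltey_eq fin_num_measure.
Qed.

(** The strong form of independence that the renewal argument needs: on an
    event [E] of the past, W_n may be averaged out with a past variable [Y]
    frozen. *)
Lemma ge0_integral_next_sojourn n (E : set T) (Y : T -> R)
    (G : R * R -> \bar R) :
  <<s cylinders n >> E ->
  measurable_fun setT (Y : g_sigma_algebraType (cylinders n) -> R) ->
  measurable_fun setT G -> (forall u, 0 <= G u) ->
  \int[P]_(w in S `&` E) G (Y w, W n w) =
  \int[P]_(w in S `&` E) \int[nu n]_s G (Y w, s).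
Proof.
move=> sE sY mG G0.
have mSE : measurable (S `&` E).
  by apply: measurableI => //; exact: measurable_past sE.
have mY : measurable_fun setT Y.
  by move=> _ A mA; apply: (@measurable_past n); exact: sY.
rewrite -!(ge0_integral_mrestr _ mSE)//.
- apply: ge0_integral_freezing => //.
  move=> A B mA mB; rewrite /= /mrestr.
  have sYA : <<s cylinders n >> (E `&` Y @^-1` A).
    apply: (@measurableI _ (g_sigma_algebraType (cylinders n))) => //.
    by rewrite -[X in measurable X]setTI; exact: sY.
  rewrite [in RHS](setIC (Y @^-1` A)) -(setIA S) -past_independence//.
  by congr (P _); rewrite [LHS]setIC !setIA.
- apply: (@measurableT_comp _ _ _ _ _ _ (fun y => \int[nu n]_s G (y, s))) => //.
  exact: measurable_fun_fubini_tonelli_F.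
- by move=> w; exact: integral_ge0.
- by apply: measurableT_comp => //; exact: measurable_fun_pair.
Qed.

End past.

(** * One exponential sojourn stopped at a deadline *)

Section exponential_deadline.
Context (R : realType) (l r : R) (F K G : R -> R).
Hypotheses (l0 : 0 < l) (r0 : 0 <= r) (Fr : F r = 0).
Hypothesis dF : forall s : R, is_derive s 1 F (l * (F s - K s) - 1).
Hypothesis cK : continuous K.
Hypothesis K0 : forall s, 0 <= s <= r -> 0 <= K s.
Hypothesis GE : forall s, G s = if 0 <= s <= r then s + K s else r.
Local Notation mu := lebesgue_measure.
Local Notation nu := (exponential_prob l).

(* A primitive of [s |-> (s + K s) * exponential_pdf l s]: the equation satisfied
   by [F] is what makes the product rule give this integrand. *)
Let Phi s := - (expR (- l * s) * (s + F s)).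

Let dPhi (s : R) : is_derive s 1 Phi (l * expR (- l * s) * (s + K s)).
Proof.
rewrite /Phi; apply: is_derive_eq.
rewrite !scaler1 /GRing.scale/=; ring.
Qed.

Let nu_seg : nu `[0, r] = (1 - expR (- l * r))%:E.
Proof.
have [->|rn0] := eqVneq r 0.
  rewrite mulr0 expR0 subrr set_itv1 /exponential_prob integral_set1//.
by rewrite exponential_prob_itv0c// lt_def rn0 r0.
Qed.

Let seg : (\int[mu]_(s in `[0%R, r]) ((G s)%:E * (exponential_pdf l s)%:E) =
  (F 0 - expR (- l * r) * r)%:E)%E.
Proof.
have [rE|rn0] := eqVneq r 0.
  by rewrite rE set_itv1 integral_set1 mulr0 subr0 -[X in F X]rE Fr.
have r_gt0 : 0 < r by rewrite lt_def rn0 r0.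
transitivity (\int[mu]_(s in `[0%R, r]) (l * expR (- l * s) * (s + K s))%:E)%E.
  apply: eq_integral => s; rewrite inE/= in_itv/= => sr.
  rewrite GE sr exponential_pdfE; last by case/andP: sr.
  by rewrite -EFinM mulrC.
rewrite (@continuous_FTC2 _ _ Phi)//.
- rewrite /Phi mulr0 expR0 Fr addr0 add0r mul1r -EFinB; congr EFin; ring.
- apply: continuous_subspaceT => s.
  apply: cvgM; last by apply: cvgD; [exact: cvg_id|exact: cK].
  apply: cvgM; first exact: cvg_cst.
  apply: continuous_comp; last exact: continuous_expR.
  by apply: cvgM; [exact: cvg_cst|exact: cvg_id].
- have cPhi s : {for s, continuous Phi}.
    by apply: differentiable_continuous; apply/derivable1_diffP; have [] := dPhi s.
  split => [s _| |]; first by have [] := dPhi s.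
  + exact/cvg_at_right_filter/cPhi.
  + exact/cvg_at_left_filter/cPhi.
- by move=> s _; rewrite derive1E; have [_ ->] := dPhi s.
Qed.

(** [G] is the reward of an exponential clock watched until the deadline [r], and
    [F 0] is its mean.  The part after the deadline contributes [r * expR (- l * r)], which
    cancels the value of the primitive at [r], where [F] vanishes. *)
Lemma integral_exponential_deadline :
  measurable_fun setT (G : measurableTypeR R -> R) ->
  (\int[nu]_s (G s)%:E = (F 0)%:E)%E.
Proof.
move=> mG.
pose nu' : probability (measurableTypeR R) R :=
  exponential_distribution_exponential_prob__canonical__probability_measure_Probability
    l0.
have G0 s : 0 <= G s.
  rewrite GE; case: ifP => // /andP[s0 sr].
  by rewrite addr_ge0// K0// s0.
rewrite -[X in integral _ X _](setUv `[0, r]%classic).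
change (\int[nu']_(s in `[0%R, r] `|` ~` `[0%R, r]) (G s)%:E = (F 0)%:E)%E.
rewrite ge0_integral_setU//; last 4 first.
- exact: measurableC.
- by apply: measurable_funTS; exact/measurable_EFinP.
- by move=> s _; rewrite lee_fin.
- exact/disj_setPCl.
rewrite (@ge0_integral_density _ _ _ mu _ (exponential_pdf l))//; last 4 first.
- exact: measurable_exponential_pdf.
- by move=> s; apply: exponential_pdf_ge0; exact: ltW.
- by apply: measurable_funTS; exact/measurable_EFinP.
- by move=> s _; rewrite lee_fin.
rewrite seg (eq_integral (fun=> r%:E)); last first.
  move=> s; rewrite inE/= in_itv/= => /negP/negbTE sr.
  by rewrite GE sr.
rewrite integral_cst//; last exact: measurableC.
have nuC : nu' (~` `[0%R, r]%classic) = (expR (- l * r))%:E.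
  by rewrite probability_setC// [nu' _]nu_seg -EFinB; congr EFin; ring.
rewrite [X in (_ + _ * X)%E]nuC -EFinM -EFinD; congr EFin; ring.
Qed.

End exponential_deadline.

Section sojourn_law.
Context (R : realType) (l : R) (l0 : 0 < l).

Let mid : measurable_fun setT (id : measurableTypeR R -> R).
Proof. by move=> _ A mA; rewrite setTI. Qed.

(** [exponential_prob l] is a measure for the sigma-algebra generated by the
    half-open intervals, whereas random variables take values in [R] with its
    default measurable structure.  The two have the same measurable sets;
    pushing forward along the identity moves the law to the latter. *)
Definition sojourn_law : probability R R :=
  distribution
    (exponential_distribution_exponential_prob__canonical__probability_measure_Probability
       l0)
    (HB.pack_for {mfun measurableTypeR R >-> R} (id : measurableTypeR R -> R)
       (isMeasurableFun.Build _ _ _ _ _ mid)).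

Lemma sojourn_lawE A : sojourn_law A = exponential_prob l A.
Proof. by []. Qed.

Lemma integral_sojourn_law (G : R -> \bar R) : measurable_fun setT G ->
  (forall s, 0 <= G s)%E ->
  (\int[sojourn_law]_s G s =
   \int[(exponential_prob l : set (measurableTypeR R) -> \bar R)]_s G s)%E.
Proof. by move=> mG G0; rewrite ge0_integral_pushforward. Qed.

End sojourn_law.

(** * The path between reversals *)

Section geometry.
Context (R : realType) (c0 c1 a b : R).
Hypotheses (c0_gt0 : 0 < c0) (c1_gt0 : 0 < c1).
Local Notation v := (signed_velocity c0 c1).

Definition end_ahead (j : bool) : R := if j == d0 then b else a.

(** Absolute values make this nonnegative also for [y] outside the segment. *)
Definition time_to_exit (j : bool) (y : R) : R := `|end_ahead j - y| / `|v j|.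

Lemma time_to_exit_ge0 j y : 0 <= time_to_exit j y.
Proof. by rewrite divr_ge0. Qed.

Lemma signed_velocity_neq0 j : v j != 0.
Proof. by case: j; rewrite /signed_velocity/= ?oppr_eq0 gt_eqF. Qed.

Lemma end_aheadE j y : y \in `[a, b] -> y + v j * time_to_exit j y = end_ahead j.
Proof.
rewrite in_itv/= /time_to_exit /end_ahead => /andP[ay yb].
case: j; rewrite /signed_velocity/=.
- rewrite normrN (gtr0_norm c1_gt0) ler0_norm ?subr_le0//.
  by field; rewrite gt_eqF.
- rewrite (gtr0_norm c0_gt0) ger0_norm ?subr_ge0//.
  by field; rewrite gt_eqF.
Qed.

Lemma in_segment_before_exit j y s : y \in `[a, b] -> 0 <= s ->
  (y + v j * s \in `[a, b]) = (s <= time_to_exit j y).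
Proof.
rewrite !in_itv/= /time_to_exit /end_ahead => /andP[ay yb] s0.
case: j; rewrite /signed_velocity/=.
- rewrite normrN (gtr0_norm c1_gt0) ler0_norm ?subr_le0//.
  rewrite ler_pdivlMr//; apply/idP/idP; first by case/andP; lra.
  by move=> h; have := mulr_ge0 s0 (ltW c1_gt0); lra.
- rewrite (gtr0_norm c0_gt0) ger0_norm ?subr_ge0//.
  rewrite ler_pdivlMr//; apply/idP/idP; first by case/andP; lra.
  by move=> h; have := mulr_ge0 s0 (ltW c0_gt0); lra.
Qed.

(** The bound is the sum of the crossing times in the two directions, so that
    it serves for both. *)
Lemma time_to_exit_le j y : y \in `[a, b] ->
  time_to_exit j y <= (b - a) * (c0^-1 + c1^-1).
Proof.
rewrite !in_itv/= /time_to_exit /end_ahead => /andP[ay yb].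
have ab : 0 <= b - a by lra.
rewrite mulrDr.
case: j; rewrite /signed_velocity/=.
- rewrite normrN (gtr0_norm c1_gt0) ler0_norm ?subr_le0//.
  rewrite -[leLHS]add0r lerD//; first by rewrite mulr_ge0// invr_ge0 ltW.
  by rewrite ler_pM2r ?invr_gt0//; lra.
- rewrite (gtr0_norm c0_gt0) ger0_norm ?subr_ge0//.
  rewrite -[leLHS]addr0 lerD//; last by rewrite mulr_ge0// invr_ge0 ltW.
  by rewrite ler_pM2r ?invr_gt0//; lra.
Qed.

End geometry.

Section skeleton.
Context (R : realType) (c0 c1 a b x : R) (j : bool).
Local Notation v := (signed_velocity c0 c1).
Implicit Types (W : nat -> R) (n : nat).

(** The position at the [n]-th reversal when the initial direction is [j]. *)
Definition turning_point W n : R := x + \sum_(i < n) v (j (+) odd i) * W i.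

(** On a leg between two points of the segment the particle does not leave it,
    so looking at the turning points is enough. *)
Definition inside_until W n : bool :=
  all (fun i => turning_point W i \in `[a, b]) (iota 0 n.+1).

(** The part of the sojourn [n] that is spent before the exit. *)
Definition sojourn_inside W n : R :=
  if inside_until W n then
    Num.min (W n) (time_to_exit c0 c1 a b (j (+) odd n) (turning_point W n))
  else 0.

Lemma turning_point0 W : turning_point W 0 = x.
Proof. by rewrite /turning_point big_ord0 addr0. Qed.

Lemma turning_pointS W n :
  turning_point W n.+1 = turning_point W n + v (j (+) odd n) * W n.
Proof. by rewrite /turning_point big_ord_recr/= addrA. Qed.

Lemma inside_untilS W n :
  inside_until W n.+1 = inside_until W n && (turning_point W n.+1 \in `[a, b]).
Proof. by rewrite /inside_until -(addn1 n.+1) iotaD all_cat/= andbT add0n. Qed.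

Lemma inside_until_turning_point W n :
  inside_until W n -> turning_point W n \in `[a, b].
Proof.
by move=> /allP; apply; rewrite mem_iota/= add0n ltnS.
Qed.

Lemma inside_until_le W m n : (m <= n)%N -> inside_until W n -> inside_until W m.
Proof.
move=> mn /allP h; apply/allP => i; rewrite mem_iota/= add0n ltnS => im.
by apply: h; rewrite mem_iota/= add0n ltnS (leq_trans im).
Qed.

End skeleton.

Section path.
Context (R : realType) (c0 c1 a b x : R) (j : bool).
Hypotheses (c0_gt0 : 0 < c0) (c1_gt0 : 0 < c1) (xab : x \in `[a, b]).
Variables (X : R -> R) (D : R -> bool) (W : nat -> R).
Local Notation v := (signed_velocity c0 c1).
Let T n := \sum_(i < n) W i.
Hypotheses (X0 : X 0 = x) (W0 : forall n, 0 < W n).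
Hypothesis T_oo : T n @[n --> \oo] --> +oo.
Hypothesis XD : forall n t, T n <= t < T n.+1 -> D t = j (+) odd n.
Hypothesis DX : forall i s t, 0 <= s <= t ->
  (forall u : R, s <= u < t -> D u = i) -> X t = X s + v i * (t - s).

Local Notation Y := (turning_point c0 c1 x j W).
Local Notation inside := (inside_until c0 c1 a b x j W).
Local Notation r n := (time_to_exit c0 c1 a b (j (+) odd n) (Y n)).
Local Notation si := (sojourn_inside c0 c1 a b x j W).

Let TS n : T n.+1 = T n + W n.
Proof. by rewrite /T big_ord_recr. Qed.

Let T_ge0 n : 0 <= T n.
Proof. by apply: sumr_ge0 => i _; exact: ltW. Qed.

Let T_le m n : (m <= n)%N -> T m <= T n.
Proof.
move=> /subnK <-; elim: (n - m)%N => [|k ih]; first by rewrite add0n.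
by rewrite addSn TS (le_trans ih)// lerDl ltW.
Qed.

Let X_leg n t : T n <= t <= T n.+1 -> X t = Y n + v (j (+) odd n) * (t - T n).
Proof.
have leg k u : T k <= u <= T k.+1 ->
    X u = X (T k) + v (j (+) odd k) * (u - T k).
  move=> /andP[ku uk]; apply: DX; first by rewrite T_ge0.
  by move=> w /andP[kw wu]; apply: XD; rewrite kw (lt_le_trans wu).
move=> nt; rewrite (leg n)//; congr (_ + _).
elim: n {t nt} => [|n ih]; first by rewrite /T big_ord0 X0 turning_point0.
rewrite (leg n); last by rewrite TS lerDl lexx andbT ltW.
by rewrite ih turning_pointS TS [T n + _]addrC addrK.
Qed.

Let leg_of t : 0 <= t -> exists n, T n <= t < T n.+1.
Proof.
move=> t0.
have ex : exists n, t < T n.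
  have /cvgryPgt/(_ t)[N _ h] := T_oo; by exists N; exact: h (leqnn N).
case: (ex_minnP ex) => -[|n] tn nmin; first by move: tn; rewrite /T big_ord0 ltNge t0.
exists n; rewrite tn andbT leNgt; apply/negP => /nmin.
by rewrite ltnn.
Qed.

Let inside_sojourn n : inside n.+1 -> W n <= r n.
Proof.
rewrite inside_untilS => /andP[/inside_until_turning_point Yn].
by rewrite turning_pointS in_segment_before_exit// ltW.
Qed.

Let sum_inside n m : inside n -> (m <= n)%N -> \sum_(i < m) si i = T m.
Proof.
move=> insn mn; apply: eq_bigr => i _.
have im : inside i.+1 by apply: inside_until_le insn; exact: leq_trans mn.
rewrite /sojourn_inside (inside_until_le _ im)//.
by apply/min_idPl; exact: inside_sojourn.
Qed.

Let inside_stays n t : inside n -> T n <= t -> t <= T n + r n -> t <= T n.+1 ->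
  X t \in `[a, b].
Proof.
move=> insn nt tr tn; rewrite (X_leg (n := n)) ?nt//.
rewrite in_segment_before_exit ?subr_ge0//; first by rewrite lerBlDl.
exact: inside_until_turning_point insn.
Qed.

Let exit := ereal_inf [set t%:E | t in [set t : R | 0 < t /\ X t \notin `[a, b]]].

Let never : (forall n, inside n) -> (\sum_(i < n) si i)%:E @[n --> \oo] --> exit.
Proof.
move=> insn; have -> : exit = +oo%E.
  rewrite /exit (_ : [set _ | _ in _] = set0) ?ereal_inf0//.
  apply/seteqP; split => // z [t [t0 /negP Xt] _]; apply: Xt.
  have [n /andP[nt tn]] := leg_of (ltW t0).
  apply: (inside_stays (insn n)) => //; last exact: ltW.
  by rewrite (le_trans (ltW tn))// TS lerD2l inside_sojourn.
under eq_fun do rewrite (sum_inside (insn _) (leqnn _)).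
exact/cvgeryP.
Qed.

Let leaves N : inside N -> ~~ inside N.+1 ->
  (\sum_(i < n) si i)%:E @[n --> \oo] --> exit.
Proof.
move=> insN; rewrite inside_untilS insN/= turning_pointS.
have YN := inside_until_turning_point insN.
rewrite in_segment_before_exit ?(ltW (W0 _))// -ltNge => rW.
have insN1 m : (N < m)%N -> ~~ inside m.
  move=> Nm; apply/negP => /(inside_until_le Nm); rewrite inside_untilS.
  by rewrite insN/= turning_pointS in_segment_before_exit ?(ltW (W0 _))// leNgt rW.
have -> : exit = (T N + r N)%:E.
  apply/eqP; rewrite eq_le; apply/andP; split; last first.
    apply: le_ereal_inf_tmp => _ [t [t0 +] <-]; rewrite lee_fin leNgt.
    apply: contra => tr.
    have [n /andP[nt tn]] := leg_of (ltW t0).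
    have nN : (n <= N)%N.
      rewrite leqNgt; apply/negP => /T_le; rewrite TS; lra.
    apply: (inside_stays (inside_until_le nN insN)) => //; last exact: ltW.
    move: nN tr; rewrite leq_eqVlt => /predU1P[->|nN tr]; first by lra.
    apply: (le_trans (ltW tn)); rewrite TS lerD2l inside_sojourn//.
    exact: inside_until_le insN.
  (* Just after the end is reached, and before the next reversal, the particle
     is outside. *)
  apply/lee_addgt0Pr => e e0.
  pose d := Num.min e ((W N - r N) / 2).
  have d0 : 0 < d by rewrite lt_min e0/=; lra.
  have dW : d <= (W N - r N) / 2 by rewrite ge_min lexx orbT.
  have rN0 : 0 <= r N by exact: time_to_exit_ge0.
  apply: (@le_trans _ _ (T N + r N + d)%:E); last first.
    by rewrite -EFinD lee_fin lerD2l ge_min lexx.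
  apply: ereal_inf_lbound; exists (T N + r N + d) => //; split.
    by have := T_ge0 N; lra.
  rewrite (X_leg (n := N)); last by rewrite TS; apply/andP; split; lra.
  rewrite in_segment_before_exit//; last by lra.
  by rewrite -ltNge; lra.
apply: cvg_near_cst; exists N.+1 => // n /= Nn.
rewrite -(subnKC Nn) big_split_ord/= big_ord_recr/= (sum_inside insN)// -/(T N).
rewrite big1 => [|i _]; last first.
  by rewrite /sojourn_inside (negbTE (insN1 _ _))// ltn_addr.
by rewrite addr0 /sojourn_inside insN; congr (_ + _)%:E; apply/min_idPr/ltW.
Qed.

(** If all the turning points are inside, the partial sums are the reversal
    times, which tend to infinity, and the path never leaves.  Otherwise let
    [N.+1] be the first turning point outside: the sums are constant from [N.+1]
    on, equal to the time at which the end is reached during the sojourn [N]. *)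
Lemma cvg_sum_sojourn_inside :
  (\sum_(i < n) si i)%:E @[n --> \oo] --> exit.
Proof.
have [insn|] := pselect (forall n, inside n); first exact: never.
move=> /existsNP[n /negP nn]; have ex : exists n, ~~ inside n by exists n.
case: (ex_minnP ex) => -[|N] insN minN.
  by move: insN; rewrite /inside_until/= turning_point0 xab.
apply: (@leaves N) => //; apply/negPn/negP => /minN; by rewrite ltnn.
Qed.

End path.

(** * Mean exit time from a boundary value problem *)

Section skeleton_measurability.
Context (R : realType) (c0 c1 a b x : R) (j : bool).
Context d (T : measurableType d) (W : nat -> T -> R).

Lemma measurable_turning_point n :
  (forall i, (i < n)%N -> measurable_fun setT (W i)) ->
  measurable_fun setT (fun w => turning_point c0 c1 x j (W ^~ w) n).
Proof.
elim: n => [|n ih] mW.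
  by under eq_fun do rewrite turning_point0; exact: measurable_cst.
under eq_fun do rewrite turning_pointS.
apply: measurable_funD; first by apply: ih => i ni; apply: mW; exact: ltnW.
by apply: measurable_funM => //; exact: mW.
Qed.

Lemma measurable_inside_until n :
  (forall i, (i < n)%N -> measurable_fun setT (W i)) ->
  measurable [set w | inside_until c0 c1 a b x j (W ^~ w) n].
Proof.
have mY m : (forall i, (i < m)%N -> measurable_fun setT (W i)) ->
    measurable [set w | turning_point c0 c1 x j (W ^~ w) m \in `[a, b]].
  move=> mW; rewrite [X in measurable X](_ : _ = setT `&`
    (fun w => turning_point c0 c1 x j (W ^~ w) m) @^-1` `[a, b]%classic); last first.
    by rewrite setTI.
  by apply: measurable_turning_point.
elim: n => [|n ih] mW.
  rewrite [X in measurable X](_ : _ =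
      [set w | turning_point c0 c1 x j (W ^~ w) 0 \in `[a, b]]); first exact: mY.
  by apply/seteqP; split=> w /=; rewrite /inside_until/= andbT.
rewrite [X in measurable X](_ : _ =
    [set w | inside_until c0 c1 a b x j (W ^~ w) n] `&`
    [set w | turning_point c0 c1 x j (W ^~ w) n.+1 \in `[a, b]]).
  by apply: measurableI; [apply: ih => i ni; apply: mW; exact: ltnW|exact: mY].
apply/seteqP; split=> w /=; rewrite inside_untilS; first by move/andP.
by move=> ?; apply/andP.
Qed.

End skeleton_measurability.

Section verification.
Context dT (T : measurableType dT) (R : realType) (P : probability T R).
Context (c0 c1 a b x : R) (lambda : bool -> R) (j : bool).
Hypotheses (c0_gt0 : 0 < c0) (c1_gt0 : 0 < c1) (lambda_gt0 : forall i, 0 < lambda i).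
Hypotheses (ltab : a < b) (xab : x \in `[a, b]).
Variables (W : nat -> {RV P >-> R}) (S : set T).
Hypotheses (W_gt0 : forall n w, 0 < W n w) (mS : measurable S).
Hypothesis SW : forall n (A : nat -> set R), (forall i, measurable (A i)) ->
  P (S `&` [set w | forall i, (i < n)%N -> A i (W i w)]) =
  (P S * \prod_(i < n) exponential_prob (lambda (j (+) odd i)) (A i))%E.
Local Notation v := (signed_velocity c0 c1).
Variable H : bool -> R -> R.
Hypothesis dH : forall i (y : R),
  is_derive y 1 (H i) ((lambda i * (H i y - H (~~ i) y) - 1) / v i).
Hypothesis H_end_ahead : forall i, H i (end_ahead a b i) = 0.
Hypothesis H_ge0 : forall i y, y \in `[a, b] -> 0 <= H i y.

Let Y n w := turning_point c0 c1 x j (W ^~ w) n.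
Let I n := [set w | inside_until c0 c1 a b x j (W ^~ w) n].
Let si n w := sojourn_inside c0 c1 a b x j (W ^~ w) n.
Let r := time_to_exit c0 c1 a b.

Let cH i : continuous (H i).
Proof.
move=> y; apply: differentiable_continuous; apply/derivable1_diffP.
by have [] := dH i y.
Qed.

Let mH i : measurable_fun setT (H i).
Proof. exact: continuous_measurable_fun. Qed.

Let mr i : measurable_fun setT (r i).
Proof.
apply: measurable_funM => //; apply: measurableT_comp => //.
exact: measurable_funB.
Qed.

(* The absolute value makes [G] nonnegative everywhere; on the segment, where
   it matters, [H] is nonnegative. *)
Let G i (u : R * R) : R :=
  if (0 <= u.2 <= r i u.1) then u.2 + `|H (~~ i) (u.1 + v i * u.2)| else r i u.1.

Let G_ge0 i u : 0 <= G i u.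
Proof.
rewrite /G; case: ifP => [/andP[u0 _]|_]; first by rewrite addr_ge0.
exact: time_to_exit_ge0.
Qed.

Let mG i : measurable_fun setT (G i).
Proof.
apply: measurable_fun_ifT.
- apply: measurable_and; first exact: measurable_fun_ler.
  by apply: measurable_fun_ler => //; apply: measurableT_comp.
- apply: measurable_funD => //; apply: measurableT_comp => //.
  apply: measurableT_comp => //; apply: measurable_funD => //.
  exact: measurable_funM.
- exact: measurableT_comp.
Qed.

Let step i y : y \in `[a, b] ->
  (\int[sojourn_law (lambda_gt0 i)]_s (G i (y, s))%:E = (H i y)%:E)%E.
Proof.
move=> yab.
have mGy : measurable_fun setT (fun s => G i (y, s)) by apply: measurableT_comp.
rewrite integral_sojourn_law//; last first.
- by move=> s; rewrite lee_fin.
- exact/measurable_EFinP.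
have dF (s : R) : is_derive s 1 (fun s => H i (y + v i * s))
    (lambda i * (H i (y + v i * s) - H (~~ i) (y + v i * s)) - 1).
  have dg : is_derive s 1 (fun s => y + v i * s) (v i).
    apply: is_derive_eq; rewrite /GRing.scale/=; ring.
  have := @is_derive1_comp _ (H i) (fun s => y + v i * s) s _ _
    (dH i (y + v i * s)) dg.
  by rewrite divfK// signed_velocity_neq0.
rewrite (@integral_exponential_deadline _ (lambda i) (r i y)
  (fun s => H i (y + v i * s)) (fun s => H (~~ i) (y + v i * s)))//=.
- by rewrite mulr0 addr0.
- exact: time_to_exit_ge0.
- by rewrite end_aheadE.
- move=> s; apply: continuous_comp; last exact: cH.
  by apply: cvgD; [exact: cvg_cst|apply: cvgM; [exact: cvg_cst|exact: cvg_id]].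
- move=> s /andP[s0 sr]; apply: H_ge0.
  by rewrite in_segment_before_exit.
- move=> s; rewrite /G/=; case: ifP => // /andP[s0 sr].
  by rewrite ger0_norm// H_ge0// in_segment_before_exit.
Qed.

Let sI m n : (n <= m)%N -> <<s cylinders W m >> (I n).
Proof.
move=> nm; apply: (@measurable_inside_until _ _ _ _ _ _ _ _
  (g_sigma_algebraType (cylinders W m))).
by move=> i ni; apply: measurable_sojourn_past; exact: leq_trans nm.
Qed.

Let mI n : measurable (I n).
Proof. by apply: measurable_inside_until => i _; exact: measurable_funPT. Qed.

Let mSI n : measurable (S `&` I n). Proof. exact: measurableI. Qed.

Let sY n :
  measurable_fun setT (Y n : g_sigma_algebraType (cylinders W n) -> R).
Proof.
apply: measurable_turning_point => i ni.
exact: measurable_sojourn_past.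
Qed.

Let mY n : measurable_fun setT (Y n).
Proof. by apply: measurable_turning_point => i _; exact: measurable_funPT. Qed.

Let msi n : measurable_fun setT (si n).
Proof.
apply: measurable_fun_ifT => //.
- apply: (measurable_fun_bool true); rewrite setTI; exact: mI.
- apply: measurable_minr; first exact: measurable_funPT.
  exact: (measurableT_comp (mr _) (mY n)).
Qed.

Let si_ge0 n w : 0 <= si n w.
Proof.
rewrite /si /sojourn_inside; case: ifP => // _.
by rewrite le_min time_to_exit_ge0 ltW.
Qed.

(* What is still to be expected at the [n]-th reversal. *)
Let M n : \bar R := (\int[P]_(w in S `&` I n) (H (j (+) odd n) (Y n w))%:E)%E.

Let I_Y n w : I n w -> Y n w \in `[a, b].
Proof. exact: inside_until_turning_point. Qed.

Let M_step n : M n = (\int[P]_(w in S) (si n w)%:E + M n.+1)%E.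
Proof.
pose i := j (+) odd n.
have iN : j (+) odd n.+1 = ~~ i by rewrite /= -addbN.
transitivity (\int[P]_(w in S `&` I n)
    \int[sojourn_law (lambda_gt0 i)]_s (G i (Y n w, s))%:E)%E.
  by apply: eq_integral => w; rewrite inE => -[_ /I_Y Yw]; rewrite step.
rewrite -(@ge0_integral_next_sojourn _ _ _ P W S mS
  (fun n => sojourn_law (lambda_gt0 (j (+) odd n))) SW n (I n) (Y n)
  (EFin \o G i))//; last 3 first.
- exact: sI.
- exact/measurable_EFinP.
- by move=> u; rewrite lee_fin.
pose h w : \bar R := `|H (~~ i) (Y n.+1 w)|%:E.
have mh : measurable_fun setT h.
  by apply/measurable_EFinP; do 2 apply: measurableT_comp => //.
have inside_split w : I n w ->
    ((G i (Y n w, W n w))%:E = (si n w)%:E + (h \_ (I n.+1)) w)%E.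
  move=> Iw; have IS : I n.+1 w <-> W n w <= r i (Y n w).
    rewrite /I/= inside_untilS Iw turning_pointS.
    by rewrite in_segment_before_exit ?(ltW (W_gt0 _ _))//; exact: I_Y.
  rewrite /G/= (ltW (W_gt0 _ _))/= /si /sojourn_inside Iw patchE.
  case: ifPn => [Wr|]; last rewrite -ltNge => rW.
    rewrite mem_set ?IS// /h -EFinD /Y turning_pointS; congr (_ + _)%:E.
    exact/esym/min_idPl.
  rewrite memNset ?adde0; last by rewrite IS => /le_lt_trans /(_ rW); rewrite ltxx.
  by congr EFin; apply/esym/min_idPr; exact: ltW.
transitivity (\int[P]_(w in S `&` I n) ((si n w)%:E + (h \_ (I n.+1)) w))%E.
  by apply: eq_integral => w; rewrite inE => -[_ Iw]; exact: inside_split.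
rewrite ge0_integralD//; last 4 first.
- by move=> w _; rewrite lee_fin.
- exact/measurable_EFinP/measurable_funTS.
- by move=> w _; apply: erestrict_ge0 => ? _; rewrite lee_fin.
- apply: measurable_funTS; apply/(measurable_restrictT _ _).1 => //.
  exact: measurable_funTS.
rewrite [X in (X + _)%E]integral_mkcondr -[X in (_ + X)%E]integral_mkcondr.
congr (_ + _)%E.
  apply: eq_integral => w _; rewrite patchE; case: ifPn => // /negP.
  by rewrite inE /I/= /si /sojourn_inside => /negP/negbTE ->.
rewrite /M iN -setIA (_ : I n `&` I n.+1 = I n.+1); last first.
  by apply/setIidPr => w; exact: inside_until_le.
apply: eq_integral => w; rewrite inE => -[_ /I_Y Yw].
by rewrite /h ger0_norm// H_ge0.
Qed.

Let M0 : M 0 = (P S * (H j x)%:E)%E.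
Proof.
rewrite /M (_ : I 0 = setT).
  rewrite setIT addbF; under eq_integral do rewrite /Y turning_point0.
  by rewrite integral_cst// muleC.
by apply/seteqP; split => // w _; rewrite /I/= /inside_until/= turning_point0 xab.
Qed.

Let sum_M n : (\int[P]_(w in S) (\sum_(i < n) si i w)%:E + M n = M 0)%E.
Proof.
elim: n => [|n ih].
  by rewrite integral0_eq ?add0e// => w _; rewrite big_ord0.
rewrite -ih (M_step n) addeA; congr (_ + _)%E.
rewrite -ge0_integralD//; last 4 first.
- by move=> w _; rewrite lee_fin sumr_ge0.
- by apply/measurable_EFinP/measurable_funTS/measurable_sum.
- by move=> w _; rewrite lee_fin.
- by apply/measurable_EFinP/measurable_funTS.
by apply: eq_integral => w _; rewrite big_ord_recr/= EFinD.
Qed.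

(* No sojourn that ends inside lasts longer than [K]; the rate [lambda d0 + lambda d1]
   dominates both rates, so a sojourn is shorter than [K] with probability at
   most [q]. *)
Let K := (b - a) * (c0^-1 + c1^-1).
Let q := 1 - expR (- (lambda d0 + lambda d1) * K).

Let K_gt0 : 0 < K.
Proof. by rewrite mulr_gt0 ?subr_gt0// addr_gt0 ?invr_gt0. Qed.

Let q_ge0 : 0 <= q.
Proof.
rewrite subr_ge0 -expR0 ler_expR mulNr oppr_le0 mulr_ge0 ?(ltW K_gt0)//.
by rewrite addr_ge0// ltW.
Qed.

Let q_lt1 : q < 1.
Proof. by rewrite ltrBlDr ltrDl expR_gt0. Qed.

Let law_ge0 i A : (0 <= exponential_prob (lambda i) A)%E.
Proof. by rewrite -(sojourn_lawE (lambda_gt0 i)). Qed.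

Let P_alive n : (P (S `&` I n) <= (q ^+ n)%:E)%E.
Proof.
apply: (@le_trans _ _
  (P (S `&` [set w | forall i, (i < n)%N -> `[0%R, K]%classic (W i w)]))).
  apply: le_measure; rewrite ?inE//.
    apply: measurableI => //; apply: (@measurable_cylinders _ _ _ _ W n).
    by exists (fun=> `[0%R, K]%classic).
  move=> w [Sw Iw]; split => // i ni; rewrite /= in_itv/= (ltW (W_gt0 _ _))/=.
  have : I i.+1 w by exact: inside_until_le Iw.
  rewrite /I/= inside_untilS => /andP[Ii].
  have Yi := inside_until_turning_point Ii.
  rewrite turning_pointS in_segment_before_exit ?(ltW (W_gt0 _ _))//.
  by move=> /le_trans; apply; exact: time_to_exit_le.
rewrite (SW n (A := fun=> `[0%R, K]%classic))//.
rewrite -[leRHS]mul1e; apply: lee_pmul => //.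
- exact: prode_ge0.
- exact: probability_le1.
elim: n => [|n ih]; first by rewrite big_ord0 expr0.
rewrite big_ord_recr/= exprSr EFinM; apply: lee_pmul => //.
  exact: prode_ge0.
rewrite exponential_prob_itv0c// -EFinB lee_fin lerD2l lerN2 ler_expR.
rewrite !mulNr lerN2 ler_wpM2r ?(ltW K_gt0)//.
by case: (j (+) odd n); rewrite ?lerDl ?lerDr ltW.
Qed.

Let M_cvg0 : M n @[n --> \oo] --> 0%E.
Proof.
have [C C_ge0 HC] : exists2 C, 0 <= C & forall i y, y \in `[a, b] -> H i y <= C.
  have bound i : exists2 C, 0 <= C & forall y, y \in `[a, b] -> H i y <= C.
    have [c cab Hc] := EVT_max (ltW ltab) (continuous_subspaceT (@cH i)).
    by exists (H i c) => //; exact: H_ge0.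
  have [C0 C0_ge0 H0] := bound d0; have [C1 C1_ge0 H1] := bound d1.
  exists (C0 + C1) => [|i y yab]; first exact: addr_ge0.
  case: i; first by rewrite (le_trans (H1 _ yab))// lerDr.
  by rewrite (le_trans (H0 _ yab))// lerDl.
have Cq : (C * q ^+ n)%:E @[n --> \oo] --> 0%E.
  apply: cvg_EFin; first exact: nearW.
  rewrite -(mulr0 C); apply: cvgM; first exact: cvg_cst.
  by apply: cvg_expr; rewrite ger0_norm.
apply: (squeeze_cvge _ (cvg_cst 0%E) Cq); apply: nearW => n; apply/andP; split.
  by apply: integral_ge0 => w [_ /I_Y Yw]; rewrite lee_fin H_ge0.
apply: (@le_trans _ _ (\int[P]_(w in S `&` I n) C%:E)%E).
  apply: ge0_le_integral => //.
  - by move=> w [_ /I_Y Yw]; rewrite lee_fin H_ge0.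
  - apply/measurable_EFinP/measurable_funTS.
    exact: (measurableT_comp (mH _) (mY n)).
  - by move=> w [_ /I_Y Yw]; rewrite lee_fin HC.
by rewrite integral_cst// EFinM lee_wpmul2l ?lee_fin//; exact: P_alive.
Qed.

Lemma measurable_exit_time (tau : T -> \bar R) :
  (forall w, S w -> (\sum_(i < n) si i w)%:E @[n --> \oo] --> tau w) ->
  measurable_fun S tau.
Proof.
move=> tauE; apply: (emeasurable_fun_cvg
  (fun n w => (\sum_(i < n) si i w)%:E)) => // n.
by apply/measurable_EFinP/measurable_funTS/measurable_sum.
Qed.

(** A nonnegative solution of the boundary value problem is the mean exit time:
    the contributions of the first [n] sojourns and the remainder [M n] add up to
    a constant, and the remainder vanishes geometrically. *)
Lemma mean_exit_time (tau : T -> \bar R) :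
  (forall w, S w -> (\sum_(i < n) si i w)%:E @[n --> \oo] --> tau w) ->
  (\int[P]_(w in S) tau w = P S * (H j x)%:E)%E.
Proof.
move=> tauE.
have sums_cvg : (\int[P]_(w in S) (\sum_(i < n) si i w)%:E)%E @[n --> \oo] -->
    (\int[P]_(w in S) tau w)%E.
  rewrite (eq_integral (fun w => limn (fun n => (\sum_(i < n) si i w)%:E)));
    last first.
    by move=> w; rewrite inE => Sw; apply/esym/cvg_lim => //; exact: tauE.
  apply: cvg_monotone_convergence => //.
  - by move=> n; apply/measurable_EFinP/measurable_funTS/measurable_sum.
  - by move=> n w _; rewrite lee_fin sumr_ge0.
  - move=> w _ m n mn; rewrite lee_fin -(subnKC mn) big_split_ord/=.
    by rewrite lerDl sumr_ge0.
have : (\int[P]_(w in S) (\sum_(i < n) si i w)%:E + M n)%E @[n --> \oo] -->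
    (\int[P]_(w in S) tau w + 0)%E.
  by apply: cvgeD => //; rewrite fin_num_adde_defl.
rewrite adde0; under eq_fun do rewrite sum_M.
by rewrite M0 => /cvg_lim <- //; rewrite lim_cst.
Qed.

End verification.

(** * The explicit solution *)

Section explicit_solution.
Context (R : realType) (lambda0 lambda1 c0 c1 a b : R).
Hypotheses (lambda0_gt0 : 0 < lambda0) (lambda1_gt0 : 0 < lambda1).
Hypotheses (c0_gt0 : 0 < c0) (c1_gt0 : 0 < c1) (ltab : a < b).
Hypothesis drift : lambda0 * c1 != lambda1 * c0.

Let k := lambda0 * c1 - lambda1 * c0.
Let m := lambda0 / c0 - lambda1 / c1.
Let e (y : R) := expR (m * y).
Let den := lambda0 * c1 * e b - lambda1 * c0 * e a.

Definition mean_exit_solution (i : bool) (x : R) : R :=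
  if i == d0 then
    (lambda0 + lambda1) / k * (x - a)
    - (lambda0 + lambda1) * (b - a) / k
      * ((lambda0 * c1 * e x - lambda1 * c0 * e a) / den)
    + lambda0 * c1 * (c0 + c1) / k * ((e b - e x) / den)
  else
    (lambda0 + lambda1) / k * (x - a)
    - lambda1 * c0 * ((c0 + c1 + (lambda0 + lambda1) * (b - a)) / k)
      * ((e x - e a) / den).
Local Notation H := mean_exit_solution.

Let mE : m = k / (c0 * c1).
Proof. by rewrite /m /k; field; rewrite !gt_eqF. Qed.

Let k_neq0 : k != 0. Proof. by rewrite subr_eq0. Qed.

Let e_gt0 y : 0 < e y. Proof. exact: expR_gt0. Qed.

Let tangent y z : e y * (1 + m * (z - y)) <= e z.
Proof.
rewrite (_ : e z = e y * expR (m * (z - y))).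
  by rewrite ler_pM2l ?e_gt0// expR_ge1Dx.
by rewrite /e -expRD; congr expR; ring.
Qed.

(* [e] increases when [k] is positive and decreases when it is negative, so that
   [den] always has the sign of [k]. *)
Let kden_gt0 : 0 < k * den.
Proof.
have ea := e_gt0 a; have eb := e_gt0 b.
have tab := tangent a b; have tba := tangent b a.
have L0 : 0 < b - a by rewrite subr_gt0.
have cc : 0 < (c0 * c1)^-1 by rewrite invr_gt0 mulr_gt0.
move: k_neq0; rewrite neq_lt => /orP[k0|k0].
- have m0 : m < 0 by rewrite mE nmulr_rlt0.
  have : e b <= e a.
    have : 0 <= m * (a - b) by nra.
    by move=> /(mulr_ge0 (ltW eb)); lra.
  rewrite nmulr_rgt0// /den => ba.
  have : lambda1 * c0 * e b <= lambda1 * c0 * e a by rewrite ler_pM2l ?mulr_gt0.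
  have : k * e b < 0 by rewrite nmulr_rlt0.
  rewrite /k; lra.
- have m0 : 0 < m by rewrite mE mulr_gt0.
  have : e a <= e b.
    have : 0 <= m * (b - a) by nra.
    by move=> /(mulr_ge0 (ltW ea)); lra.
  rewrite pmulr_rgt0// /den => ba.
  have : lambda0 * c1 * e a <= lambda0 * c1 * e b by rewrite ler_pM2l ?mulr_gt0.
  have : 0 < k * e a by rewrite mulr_gt0.
  rewrite /k; lra.
Qed.

Let den_neq0 : den != 0.
Proof. by apply/eqP => den0; have := kden_gt0; rewrite den0 mulr0 ltxx. Qed.

Lemma mean_exit_denominator_neq0 :
  lambda0 * c1 * expR ((lambda0 / c0 - lambda1 / c1) * b)
  - lambda1 * c0 * expR ((lambda0 / c0 - lambda1 / c1) * a) != 0.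
Proof. exact: den_neq0. Qed.

Let de (y : R) : is_derive y 1 e (m * e y).
Proof. by rewrite /e; apply: is_derive_eq; rewrite /GRing.scale/=; ring. Qed.

Lemma mean_exit_solution_ode i (y : R) :
  is_derive y 1 (H i) ((intensity lambda0 lambda1 i * (H i y - H (~~ i) y) - 1)
                       / signed_velocity c0 c1 i).
Proof.
rewrite /H /intensity /signed_velocity.
case: i => /=; apply: is_derive_eq; rewrite /GRing.scale/= -?/(e y) mE /den /k.
all: field; rewrite -/k -/den ?k_neq0 ?den_neq0 ?gt_eqF//.
Qed.

Lemma mean_exit_solution_end_ahead i : H i (end_ahead a b i) = 0.
Proof.
by case: i; rewrite /H /end_ahead/= /den; field; rewrite -/den k_neq0 den_neq0.
Qed.

(* Average the tangents at [y], evaluated at the two ends. *)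
Let chord y : a <= y <= b -> e y * (b - a) <= (b - y) * e a + (y - a) * e b.
Proof.
move=> /andP[ay yb]; have ta := tangent y a; have tb := tangent y b.
have : (b - y) * (e y * (1 + m * (a - y))) <= (b - y) * e a.
  by rewrite ler_wpM2l// subr_ge0.
have : (y - a) * (e y * (1 + m * (b - y))) <= (y - a) * e b.
  by rewrite ler_wpM2l// subr_ge0.
nra.
Qed.

(** Both functions are affine in [x] minus a positive multiple of [e x], thus
    concave; they are bounded below by their chord over the segment.  The chord
    vanishes at the end ahead, and at the end behind its sign is settled by the
    tangent inequality between [e a] and [e b]. *)
Lemma mean_exit_solution_ge0 i y : y \in `[a, b] -> 0 <= H i y.
Proof.
rewrite in_itv/= => yab; have ch := chord yab; case/andP: yab => ay yb.
have L0 : 0 < b - a by rewrite subr_gt0.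
have L_neq0 : b - a != 0 by rewrite gt_eqF.
have tab := tangent a b; have tba := tangent b a.
(* [gap] is [b - a] times the height at [y] of the chord above [e].  Both
   decompositions below read: concavity defect, plus chord between the values at
   the ends. *)
pose gap := (b - y) * e a + (y - a) * e b - e y * (b - a).
have gap_ge0 : 0 <= gap by rewrite subr_ge0.
have [l0_ge0 l1_ge0] := (ltW lambda0_gt0, ltW lambda1_gt0).
have [c0_ge0 c1_ge0] := (ltW c0_gt0, ltW c1_gt0).
have [ea_ge0 eb_ge0] := (ltW (e_gt0 a), ltW (e_gt0 b)).
have L_ge0 := ltW L0.
have tab_ge0 : 0 <= e b - e a * (1 + m * (b - a)) by rewrite subr_ge0.
have tba_ge0 : 0 <= e a - e b * (1 + m * (a - b)) by rewrite subr_ge0.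
have [ay_ge0 yb_ge0] : 0 <= y - a /\ 0 <= b - y by rewrite !subr_ge0.
have k0_ge0 : 0 <= k ^+ 2 / c0 by rewrite mulr_ge0 ?sqr_ge0 ?invr_ge0.
have k1_ge0 : 0 <= k ^+ 2 / c1 by rewrite mulr_ge0 ?sqr_ge0 ?invr_ge0.
case: i.
- rewrite (_ : H d1 y =
    (lambda1 * c0 * (c0 + c1 + (lambda0 + lambda1) * (b - a)) * gap
     + (y - a) * (lambda1 * c0 * (c0 + c1) * (e a - e b * (1 + m * (a - b)))
                  + (b - a) * e b * (k ^+ 2 / c1))) / (b - a) / (k * den)).
    apply: divr_ge0; last exact: ltW.
    apply: divr_ge0; last exact: ltW.
    by repeat first [assumption | apply: addr_ge0 | apply: mulr_ge0].
  rewrite /H/= /gap mE /den /k; field.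
  by rewrite -/k -/den L_neq0 k_neq0 den_neq0 !gt_eqF.
- rewrite (_ : H d0 y =
    (lambda0 * c1 * (c0 + c1 + (lambda0 + lambda1) * (b - a)) * gap
     + (b - y) * (lambda0 * c1 * (c0 + c1) * (e b - e a * (1 + m * (b - a)))
                  + (b - a) * e a * (k ^+ 2 / c0))) / (b - a) / (k * den)).
    apply: divr_ge0; last exact: ltW.
    apply: divr_ge0; last exact: ltW.
    by repeat first [assumption | apply: addr_ge0 | apply: mulr_ge0].
  rewrite /H/= /gap mE /den /k; field.
  by rewrite -/k -/den L_neq0 k_neq0 den_neq0 !gt_eqF.
Qed.

End explicit_solution.

(** * The telegraph process *)

Section telegraph_exit.
Context (dT : measure_display) (T : measurableType dT) (R : realType).
Context (P : probability T R) (lambda0 lambda1 c0 c1 a b x : R).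
Variables (X : R -> {RV P >-> R}) (D : R -> {RV P >-> bool}).
Hypotheses (lambda0_gt0 : 0 < lambda0) (lambda1_gt0 : 0 < lambda1).
Hypotheses (c0_gt0 : 0 < c0) (c1_gt0 : 0 < c1).
Hypotheses (ltab : a < b) (xab : x \in `[a, b]).
Variables (W : nat -> {RV P >-> R}).
Hypothesis XDW : telegraph_with c0 c1 lambda0 lambda1 x X D W.

Let intensity_gt0 i : 0 < intensity lambda0 lambda1 i.
Proof. by case: i. Qed.

Let mD j : measurable [set w | D 0 w = j].
Proof.
rewrite [X in measurable X](_ : _ = setT `&` D 0 @^-1` [set j]).
  exact: measurable_funPT.
by rewrite setTI.
Qed.

Let exit_cvg j w : D 0 w = j ->
  (\sum_(i < n) sojourn_inside c0 c1 a b x j (W ^~ w) i)%:E @[n --> \oo] -->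
  exit_time a b X w.
Proof.
move=> Dj; apply: (@cvg_sum_sojourn_inside _ c0 c1 a b x j _ _ _
  (X ^~ w) (D ^~ w)) => //.
- exact: (tp_start XDW).
- by move=> n; exact: (tp_sojourn_gt0 XDW).
- exact: (tp_nonexplosive XDW).
- by move=> n t ntn; rewrite -Dj; exact: (tp_direction XDW).
- by move=> i s t st DX; exact: (tp_motion XDW).
Qed.

Lemma measurable_telegraph_exit j :
  measurable_fun [set w | D 0 w = j] (exit_time a b X).
Proof.
by apply: (@measurable_exit_time _ _ _ P c0 c1 a b x j W) => //; exact: exit_cvg.
Qed.

Lemma mean_telegraph_exit (H : bool -> R -> R) j :
  (forall i (y : R), is_derive y 1 (H i)
    ((intensity lambda0 lambda1 i * (H i y - H (~~ i) y) - 1)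
     / signed_velocity c0 c1 i)) ->
  (forall i, H i (end_ahead a b i) = 0) ->
  (forall i y, y \in `[a, b] -> 0 <= H i y) ->
  (\int[P]_(w in [set w | D 0 w = j]) exit_time a b X w = (2^-1 * H j x)%:E)%E.
Proof.
move=> dH H_end H_ge0.
rewrite (@mean_exit_time _ _ _ P c0 c1 a b x (intensity lambda0 lambda1) j
  c0_gt0 c1_gt0 intensity_gt0 ltab xab W _ _ _ _ H dH H_end H_ge0)//.
- by rewrite (tp_direction0 XDW) EFinM.
- by move=> n w; exact: (tp_sojourn_gt0 XDW).
- by move=> n A mA; exact: (tp_sojourn XDW).
- exact: exit_cvg.
Qed.

Lemma integral_exit_split :
  (\int[P]_w exit_time a b X w =
   \int[P]_(w in [set w | D 0 w = d0]) exit_time a b X w +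
   \int[P]_(w in [set w | D 0 w = d1]) exit_time a b X w)%E.
Proof.
have DT : [set: T] = [set w | D 0 w = d0] `|` [set w | D 0 w = d1].
  apply/esym/seteqP; split => // w _; rewrite /setU/= /d0 /d1.
  by case: (D 0 w); [right|left].
rewrite {1}DT ge0_integral_setU//.
- apply/measurable_funU => //; split; exact: measurable_telegraph_exit.
- move=> w _; apply: le_ereal_inf_tmp => _ [t [t0 _] <-].
  by rewrite lee_fin ltW.
- apply/disj_setPS => w [/= -> ]; by [].
Qed.

End telegraph_exit.

Theorem theorem4 (dT : measure_display) (T : measurableType dT) (R : realType)
    (P : probability T R) (lambda0 lambda1 c0 c1 a b x : R)
    (X : R -> {RV P >-> R}) (D : R -> {RV P >-> bool})
    (lambda0_gt0 : 0 < lambda0) (lambda1_gt0 : 0 < lambda1)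
    (c0_gt0 : 0 < c0) (c1_gt0 : 0 < c1)
    (drift : lambda0 * c1 != lambda1 * c0)
    (ltab : a < b) (xab : x \in `[a, b])
    (XD : telegraph_process c0 c1 lambda0 lambda1 x X D) :
  let tau := exit_time a b X in
  let h_ j := cond_expectation P tau [set w | X 0 w = x /\ D 0 w = j] in
  let h := cond_expectation P tau [set w | X 0 w = x] in
  let e (y : R) := expR ((lambda0 / c0 - lambda1 / c1) * y) in
  [/\ h_ d0 =
        ((lambda0 + lambda1) / (lambda0 * c1 - lambda1 * c0) * (x - a)
         - (lambda0 + lambda1) * (b - a) / (lambda0 * c1 - lambda1 * c0)
           * ((lambda0 * c1 * e x - lambda1 * c0 * e a)
              / (lambda0 * c1 * e b - lambda1 * c0 * e a))
         + lambda0 * c1 * (c0 + c1) / (lambda0 * c1 - lambda1 * c0)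
           * ((e b - e x)
              / (lambda0 * c1 * e b - lambda1 * c0 * e a)))%:E,
      h_ d1 =
        ((lambda0 + lambda1) / (lambda0 * c1 - lambda1 * c0) * (x - a)
         - lambda1 * c0
           * ((c0 + c1 + (lambda0 + lambda1) * (b - a))
              / (lambda0 * c1 - lambda1 * c0))
           * ((e x - e a)
              / (lambda0 * c1 * e b - lambda1 * c0 * e a)))%:E,
      h = ((h_ d0 + h_ d1) * (2^-1)%:E)%E
    & h =
        ((lambda0 + lambda1) / (lambda0 * c1 - lambda1 * c0) * (x - a)
         - (lambda0 + lambda1) * (b - a)
             / (2 * (lambda0 * c1 - lambda1 * c0))
           * (((lambda0 * c1 + lambda1 * c0) * e x - 2 * lambda1 * c0 * e a)
              / (lambda0 * c1 * e b - lambda1 * c0 * e a))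
         + (c0 + c1) / (2 * (lambda0 * c1 - lambda1 * c0))
           * ((lambda0 * c1 * e b - (lambda0 * c1 + lambda1 * c0) * e x
               + lambda1 * c0 * e a)
              / (lambda0 * c1 * e b - lambda1 * c0 * e a)))%:E].
Proof.
case: XD => W XDW tau h_ h e.
pose H := mean_exit_solution lambda0 lambda1 c0 c1 a b.
have dH : forall i (y : R), is_derive y 1 (H i)
    ((intensity lambda0 lambda1 i * (H i y - H (~~ i) y) - 1)
     / signed_velocity c0 c1 i).
  exact: mean_exit_solution_ode.
have H_end : forall i, H i (end_ahead a b i) = 0.
  exact: mean_exit_solution_end_ahead.
have H_ge0 : forall i y, y \in `[a, b] -> 0 <= H i y.
  exact: mean_exit_solution_ge0.
have Htau j := mean_telegraph_exit lambda0_gt0 lambda1_gt0 c0_gt0 c1_gt0 ltab xab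
  XDW j dH H_end H_ge0.
have half j : [set w | X 0 w = x /\ D 0 w = j] = [set w | D 0 w = j].
  apply/seteqP; split => w /=; first by case.
  by split=> //; exact: (tp_start XDW).
have hE j : h_ j = (H j x)%:E.
  rewrite /h_ /cond_expectation half Htau (tp_direction0 XDW) inver.
  by rewrite gt_eqF// -EFinM /H; congr EFin; field.
have hsum : h = ((h_ d0 + h_ d1) * (2^-1)%:E)%E.
  rewrite /h /cond_expectation (_ : [set w | X 0 w = x] = setT); last first.
    by apply/seteqP; split => // w _; exact: (tp_start XDW).
  rewrite probability_setT inve1 mule1.
  rewrite (integral_exit_split c0_gt0 c1_gt0 xab XDW).
  by rewrite !Htau !hE -!EFinD -EFinM /H; congr EFin; field.
split => //; rewrite ?hE//.
rewrite hsum !hE -EFinD -EFinM; congr EFin.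
rewrite /H /mean_exit_solution/= -/(e x) -/(e a) -/(e b).
have den_neq0 : lambda0 * c1 * e b - lambda1 * c0 * e a != 0.
  exact: mean_exit_denominator_neq0.
by field; rewrite den_neq0 subr_eq0.
Qed.
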